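(* Let $u\in X$ be the unique solution of $$\mathcal{F}[\xi,u]=f\ \text{ in }Q,\qquad \mathcal{B}u=g\ \text{ on }\Gamma, \tag{P}$$ and let $(u,v=0)$ be the solution of the saddle-point problem $\inf_{w\in X}\sup_{q\in Z^*}\mathcal{L}(w,q)$, where $$\mathcal{L}(w,q)=\tfrac12\|\mathcal{B}w-g\|_P^2+\langle\mathcal{F}[\xi,w]-f,\,q\rangle_{Z,Z^*}.$$ Let $(u_n,v_n)\in\mathcal{U}_\theta\times\mathcal{V}_\tau\subset X\times Z^*$ be generated by the alternating gradient descent--ascent algorithm described in the context. Then $$\|u_n-u\|_X^2+\|v_n-v\|_{Z^*}^2\le C\,(I_{MC}+I_{NN}+I_{GP}),$$ where $C$ depends only on $Q$, $\mathcal{F}$ and $\mathcal{B}$, and $$I_{NN}=|\mathcal{L}(u_n,\tilde v)-\mathcal{L}(u_n,q_{\tilde v})|+|\mathcal{L}(\tilde u,v_n)-\mathcal{L}(w_{\tilde u},v_n)|,$$ $$I_{MC}=|\mathcal{L}(u_n,q_{\tilde v})-\hat{\mathcal{L}}(u_n,q_{\tilde v})|+|\mathcal{L}(w_{\tilde u},v_n)-\hat{\mathcal{L}}(w_{\tilde u},v_n)|,$$ $$I_{GP}=\sup_{q\in\mathcal{V}_\tau}\hat{\mathcal{L}}(u_n,q)-\inf_{w\in\mathcal{U}_\theta}\hat{\mathcal{L}}(w,v_n).$$ Here $\tilde v=R_Z(\mathcal{F}[\xi,u_n]-f)\in Z^*$, where $R_Z:Z\to Z^*$ is the Riesz map, $\langle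 R_Zz,w\rangle_{Z^*,Z}=(z,w)_Z$; $\tilde u\in X$ is the solution of $$\mathcal{F}[\xi,\tilde u]-f=-R_Z^{-1}v_n\ \text{ in }Q,\qquad \mathcal{B}\tilde u=g\ \text{ on }\Gamma;$$ and $$q_{\tilde v}=\arg\min_{q\in\mathcal{V}_\tau}\|q-\tilde v\|_{Z^*},\qquad w_{\tilde u}=\arg\min_{w\in\mathcal{U}_\theta}\|w-\tilde u\|_X .$$
   Context: $Q\subset\mathbb{R}^d$ ($d>1$) is a bounded domain, $\Gamma\subset\partial Q$ the part of the boundary where boundary conditions are imposed. $X$ is a real Banach space of functions on $Q$, $Z$ a real Hilbert space of functions on $Q$ with inner product $(\cdot,\cdot)_Z$, dual $Z^*$ and duality pairing $\langle\cdot,\cdot\rangle_{Z,Z^*}$, and $P$ a real Banach space of functions on $\Gamma$; $f\in Z$, $g\in P$. Standing assumptions: the differential operator $u\mapsto\mathcal{F}[\xi,u]$, $X\to Z$, and the boundary operator $\mathcal{B}:X\to P$ are linear; the problem is well-posed, i.e. for all data $(f,g)\in Z\times P$ problem (P) has a unique solution $u\in X$, and the solution satisfies the stability estimate $$\|u\|_X^2\le C_0\big(\|f\|_Z^2+\|g\|_P^2\big)$$ with $C_0$ depending only on $Q$, $\mathcal{F}$ and $\mathcal{B}$. $\mathcal{U}_\theta\subset X$ and $\mathcal{V}_\tau\subset Z^*$ are sets of neural-network functions $u_\theta$, $v_\tau$ parameterized by $\theta\in\mathbb{R}^p$ and $\tau\in\mathbb{R}^q$. $\hat{\mathcal{L}}(u_\theta,v_\tau)$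 is a discrete (empirical) approximation of $\mathcal{L}$, obtained by replacing the integrals in $\mathcal{L}$ by sums over sampling points in $Q$ and $\Gamma$. The algorithm: starting from initial parameters $(\theta_0,\tau_0)$, in each epoch (with learning rates $\eta_\theta,\eta_\tau$ multiplied by a factor $\gamma\in(0,1)$ after every fixed number of epochs) sample interior and boundary points, perform $l$ ascent steps $\tau\leftarrow\tau+\eta_\tau\nabla_\tau\hat{\mathcal{L}}$ and then $k$ descent steps $\theta\leftarrow\theta-\eta_\theta\nabla_\theta\hat{\mathcal{L}}$; $(u_n,v_n)$ is the pair of network functions produced after $n$ steps. *)

(* Defs.v *)
From HB Require Import structures.
From mathcomp Require Import all_boot all_order all_algebra.
From mathcomp Require Import all_classical all_reals all_analysis.
From mathcomp Require Import ring.

Set Implicit Arguments.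
Unset Strict Implicit.
Unset Printing Implicit Defensive.
Import Order.TTheory GRing.Theory Num.Theory.
Import numFieldNormedType.Exports.
Local Open Scope classical_set_scope.
Local Open Scope ring_scope.

HB.mixin Record isRealHilbert (R : realType) T of CompleteNormedModule R T := {
  hdot : {dot T for (@idfun R)} ;
  hdot_normE : forall x : T, (hdot : T -> T -> R) x x = `|x| ^+ 2
}.

#[short(type="realHilbertType")]
HB.structure Definition RealHilbert (R : realType) :=
  {T of CompleteNormedModule R T & isRealHilbert R T}.

Section dual.
Context (R : realType) (V : normedModType R).

Definition dual_pred : {pred V -> R} :=
  mem [set q : V -> R | scalar q /\ continuous q].

Record dual := Dual { dual_fun :> V -> R ; _ : dual_fun \in dual_pred }.

HB.instance Definition _ := [isSub for dual_fun].
HB.instance Definition _ := [Choice of dual by <:].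

Lemma dual_linear (q : dual) : scalar q.
Proof. by case: q => q /= qP; case: (set_mem qP). Qed.

Lemma dual_continuous (q : dual) : continuous q.
Proof. by case: q => q /= qP; case: (set_mem qP). Qed.

Lemma dual_submod_closed : submod_closed dual_pred.
Proof.
split.
  apply/mem_set; split; last by move=> x; exact: cvg_cst.
  by move=> a x y /=; rewrite mulr0 addr0.
move=> a f g /set_mem[lf cf] /set_mem[lg cg]; apply/mem_set; split.
  move=> b x y; rewrite !fctE /= lf lg /GRing.scale /=.
  by rewrite !mulrDr !mulrA (mulrC a b) addrACA.
by move=> x; apply: cvgD; [apply: cvgZr; exact: cf|exact: cg].
Qed.

HB.instance Definition _ :=
  GRing.isSubmodClosed.Build _ _ dual_pred dual_submod_closed.
HB.instance Definition _ := [SubChoice_isSubLmodule of dual by <:].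

Definition dual_values (q : dual) : set R :=
  [set `|q x| | x in [set x : V | `|x| <= 1]].

Definition dual_norm (q : dual) : R := sup (dual_values q).

Lemma dualZ (q : dual) (a : R) x : q (a *: x) = a * q x.
Proof.
have q0 : q 0 = 0.
  by have := dual_linear q (-1) 0 0; rewrite scaler0 addr0 mulN1r addNr.
by have := dual_linear q a x 0; rewrite !addr0 q0 addr0.
Qed.

Lemma dual_has_sup (q : dual) : has_sup (dual_values q).
Proof.
split; first by exists `|q 0|, 0 => //=; rewrite normr0.
pose q' : V -> R^o := q.
have ql : linear q' by exact: dual_linear.
pose Q : {linear V -> R^o} :=
  HB.pack q' (GRing.isLinear.Build R V R^o *:%R q' ql).
have /linear_bounded_continuous/linear_boundedP : continuous Q.
  exact: dual_continuous.
move=> /pinfty_ex_gt0[M M0 Mq]; exists M => _ [x /= x1 <-].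
by rewrite (le_trans (Mq x))// ler_piMr// ltW.
Qed.

Lemma dual_norm_ub (q : dual) x : `|x| <= 1 -> `|q x| <= dual_norm q.
Proof. by move=> x1; apply: (sup_upper_bound (dual_has_sup q)); exists x. Qed.

Lemma dual_norm_le (q : dual) M :
  (forall x, `|x| <= 1 -> `|q x| <= M) -> dual_norm q <= M.
Proof.
move=> qM; apply: ge_sup; first by case: (dual_has_sup q).
by move=> _ [x /= x1 <-]; exact: qM.
Qed.

Lemma dual_normD (p q : dual) : dual_norm (p + q) <= dual_norm p + dual_norm q.
Proof.
apply: dual_norm_le => x x1.
by rewrite (le_trans (ler_normD _ _))// lerD// dual_norm_ub.
Qed.

Lemma dual_normZ (a : R) (q : dual) : dual_norm (a *: q) = `|a| * dual_norm q.
Proof.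
have le b p : dual_norm (b *: p) <= `|b| * dual_norm p.
  apply: dual_norm_le => x x1.
  by rewrite [leLHS]normrM ler_wpM2l// dual_norm_ub.
apply/eqP; rewrite eq_le le /=.
have [->|a0] := eqVneq a 0.
  by rewrite normr0 mul0r; apply: le_trans (dual_norm_ub _ (x := 0) _); rewrite ?normr0.
rewrite mulrC -ler_pdivlMr ?normr_gt0// mulrC -normfV.
by have := le a^-1 (a *: q); rewrite scalerA mulVf// scale1r.
Qed.

Lemma dual_norm_eq0 (q : dual) : dual_norm q = 0 -> q = 0.
Proof.
move=> q0; apply/val_inj/funext => x /=.
have [->|x0] := eqVneq x 0; first by rewrite -[0 in LHS](scale0r 0) dualZ mul0r.
have : `|q (`|x|^-1 *: x)| <= 0.
  rewrite -q0 dual_norm_ub// normrZ normfV normr_id mulVf// normr_eq0//.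
rewrite normr_le0 dualZ mulf_eq0 invr_eq0 normr_eq0 (negbTE x0) /=.
by move/eqP.
Qed.

HB.instance Definition _ :=
  @Lmodule_isNormed.Build R dual dual_norm dual_normD dual_normZ dual_norm_eq0.

End dual.

Section riesz.
Context (R : realType) (Z : realHilbertType R).
Implicit Types x y z : Z.

Lemma hdotC x y : hdot x y = hdot y x.
Proof. by rewrite [LHS](@hermitian_subproof _ _ _ _ hdot) expr0 mul1r. Qed.

Lemma hdotP z : scalar (hdot z : Z -> R).
Proof. by move=> a x y; rewrite linearDr linearZr. Qed.

Lemma hdot0 x : hdot x 0 = 0.
Proof. by have := hdotP x (-1) 0 0; rewrite scaler0 addr0 mulN1r addNr. Qed.

Lemma normD_hdot a b x y :
  `|a *: x + b *: y| ^+ 2 =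
  a ^+ 2 * `|x| ^+ 2 + a * b * hdot x y *+ 2 + b ^+ 2 * `|y| ^+ 2.
Proof.
have E z : hdot z (a *: x + b *: y) = a * hdot z x + b * hdot z y.
  by rewrite hdotP -[b *: y]addr0 hdotP hdot0 addr0.
by rewrite -!hdot_normE E !(hdotC (_ + _)) !E (hdotC y x); ring.
Qed.

Lemma hdot_CS x y : `|hdot x y| <= `|x| * `|y|.
Proof.
have [->|y0] := eqVneq y 0; first by rewrite hdot0 !normr0 mulr0.
rewrite -(@ler_pXn2r _ 2) ?nnegrE ?mulr_ge0// real_normK ?num_real// exprMn.
have y2 : 0 < `|y| ^+ 2 by rewrite exprn_gt0// normr_gt0.
rewrite -subr_ge0 -(pmulr_rge0 _ y2).
have := sqr_ge0 `| `|y| ^+ 2 *: x + (- hdot x y) *: y|.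
by rewrite normD_hdot; congr (0 <= _); ring.
Qed.

Lemma riesz_subproof z : (hdot z : Z -> R) \in @dual_pred R Z.
Proof.
apply/mem_set; split; first exact: hdotP.
pose q' : Z -> R^o := hdot z.
pose Q : {linear Z -> R^o} :=
  HB.pack q' (GRing.isLinear.Build R Z R^o *:%R q' (hdotP z)).
apply/(@linear_bounded_continuous _ _ _ Q)/linear_boundedP.
have : \forall M \near +oo, `|z| <= M by apply: nbhs_pinfty_ge; rewrite num_real.
by apply: filterS => M zM x; apply: le_trans (hdot_CS z x) _; rewrite ler_wpM2r.
Qed.

Definition riesz z : dual Z := Dual (riesz_subproof z).

(** [riesz] is bijective by the Riesz representation theorem, so the default
    value [0] is never used. *)
Definition riesz_inv (q : dual Z) : Z := xget 0 [set z | riesz z = q].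

End riesz.

Section spaces.
Context (R : realType) (d : nat).
Implicit Types D Q : set 'rV[R]_d.

Definition is_domain Q := [/\ open Q, connected Q & Q !=set0].

Definition boundary Q := closure Q `\` interior Q.

(** [V] is a vector space of functions on [D], [ev x] being the function that
    [x : V] stands for. For spaces of classes of functions (L^2, H^s, ...),
    [ev] is a linear choice of representatives. *)
Definition function_space_on D (V : lmodType R) (ev : V -> 'rV[R]_d -> R) :=
  (forall (a : R) (x y : V) t, D t -> ev (a *: x + y) t = a * ev x t + ev y t)
  /\ (forall x y : V, (forall t, D t -> ev x t = ev y t) -> x = y).

End spaces.

Section problem.
Context (R : realType) (X : normedModType R) (Z : realHilbertType R)
  (P : normedModType R) (A : X -> Z) (B : X -> P).

Definition solves (f : Z) (g : P) (u : X) := A u = f /\ B u = g.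

Definition well_posed :=
  (forall f g, exists! u, solves f g u) /\
  (exists C0 : R, forall f g u, solves f g u ->
     `|u| ^+ 2 <= C0 * (`|f| ^+ 2 + `|g| ^+ 2)).

Definition lagrangian (f : Z) (g : P) (w : X) (q : dual Z) : R :=
  2^-1 * `|B w - g| ^+ 2 + q (A w - f).

End problem.

Definition saddle_solution (R : realType) (S T : Type) (L : S -> T -> R)
    (u : S) (v : T) :=
  [/\ forall q, L u q <= L u v,
      forall w, L u v <= L w v
    & (L u v)%:E = ereal_inf (range (fun w =>
                     ereal_sup (range (fun q => (L w q)%:E))))].

Definition is_argmin (R : realType) (T : Type) (A : set T) (J : T -> R) (a : T) :=
  A a /\ forall b, A b -> J a <= J b.

Section sampling.
Context (R : realType) (d : nat) (D : set 'rV[R]_d) (H : Type).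

Definition tuples_in (m : nat) : set (m.-tuple 'rV[R]_d) :=
  [set t | forall i, D (tnth t i)].

(** A formula for [J h] as an integral over [D ^ m]: [m = 1] is an integral over
    [D]; [m = 2] covers the double integrals of Sobolev-Slobodeckij norms. *)
Record integral_form (J : H -> R) := IntegralForm {
  arity : nat ;
  base_measure : {measure set
    (arity.-tuple (g_sigma_algebraType (@open 'rV[R]_d))) -> \bar R} ;
  integrand : H -> arity.-tuple 'rV[R]_d -> R ;
  _ : measurable (@tuples_in arity :
        set (arity.-tuple (g_sigma_algebraType (@open 'rV[R]_d)))) ;
  _ : forall h, base_measure.-integrable (@tuples_in arity)
                  (fun t => (integrand h t)%:E) ;
  _ : forall h, (J h)%:E =
        (\int[base_measure]_(t in @tuples_in arity) (integrand h t)%:E)%E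
}.

(** Weighted nodes with all points in [D]; the plain Monte Carlo rule for [N]
    points has weights [measure of D / N]. *)
Record sample (J : H -> R) (I : integral_form J) := Sample {
  nodes : seq (R * (arity I).-tuple 'rV[R]_d) ;
  _ : forall p, p \in nodes -> tuples_in p.2
}.

Definition empirical (J : H -> R) (I : integral_form J) (s : sample I) (h : H) : R :=
  \sum_(p <- nodes s) p.1 * @integrand J I h p.2.

End sampling.

Section empirical_lagrangian.
Context (R : realType) (d : nat) (Q Gamma : set 'rV[R]_d)
  (X : normedModType R) (Z : realHilbertType R) (P : normedModType R)
  (A : X -> Z) (B : X -> P) (f : Z) (g : P).

(** the two integrals in the Lagrangian; the integrands may depend on [(w, q)]
    otherwise than through the residual (e.g. after integration by parts) *)
Definition interior_integral :=
  integral_form Q (fun wq : X * dual Z => wq.2 (A wq.1 - f)).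
Definition boundary_integral :=
  integral_form Gamma (fun w : X => `|B w - g| ^+ 2).

Definition empirical_lagrangian (IQ : interior_integral) (IG : boundary_integral)
    (s : sample IQ * sample IG) (w : X) (q : dual Z) : R :=
  2^-1 * empirical s.2 w + empirical s.1 (w, q).

End empirical_lagrangian.

Section algorithm.
Context (R : realType).

Definition grad (m : nat) (phi : 'rV[R]_m -> R) (x : 'rV[R]_m) : 'rV[R]_m :=
  \row_i 'D_(delta_mx 0 i) (phi : 'rV[R]_m -> R^o) x.

Context (X Y : Type) (p q : nat)
  (uNN : 'rV[R]_p -> X) (vNN : 'rV[R]_q -> Y)
  (Lhat : nat -> X -> Y -> R)   (* one empirical functional per epoch *)
  (l k s : nat) (eta_theta eta_tau gamma : R).

(** Step number [i] (from 0) belongs to epoch [i %/ (l + k)]; the first [l] steps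
    of an epoch are ascent steps in tau, the next [k] descent steps in theta; the
    rates are multiplied by [gamma] every [s] epochs. *)
Definition gda_step (i : nat) (st : 'rV[R]_p * 'rV[R]_q) : 'rV[R]_p * 'rV[R]_q :=
  let: (theta, tau) := st in
  let e := (i %/ (l + k))%N in
  let decay := gamma ^+ (e %/ s) in
  if (i %% (l + k) < l)%N
  then (theta, tau + (decay * eta_tau) *:
                 grad (fun t => Lhat e (uNN theta) (vNN t)) tau)
  else (theta - (decay * eta_theta) *:
                 grad (fun t => Lhat e (uNN t) (vNN tau)) theta, tau).

Definition gda_params (theta0 : 'rV[R]_p) (tau0 : 'rV[R]_q) (n : nat) :=
  iteri n gda_step (theta0, tau0).

Definition gda (theta0 : 'rV[R]_p) (tau0 : 'rV[R]_q) (n : nat) : X * Y :=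
  let: (theta, tau) := gda_params theta0 tau0 n in (uNN theta, vNN tau).

End algorithm.

Section errors.
Context (R : realType) (X Y : Type) (L Lhat : X -> Y -> R).

Definition I_NN (un : X) (vn : Y) (tu wu : X) (tv qv : Y) : R :=
  `|L un tv - L un qv| + `|L tu vn - L wu vn|.

Definition I_MC (un : X) (vn : Y) (wu : X) (qv : Y) : R :=
  `|L un qv - Lhat un qv| + `|L wu vn - Lhat wu vn|.

(** extended-real valued: the supremum and the infimum may be infinite *)
Definition I_GP (U : set X) (V : set Y) (un : X) (vn : Y) : \bar R :=
  (ereal_sup [set (Lhat un q)%:E | q in V] -
   ereal_inf [set (Lhat w vn)%:E | w in U])%E.

End errors.

(* Main.v *)
Require Import Defs.
From mathcomp Require Import all_boot all_order all_algebra.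
From mathcomp Require Import all_classical all_reals all_analysis.
From mathcomp Require Import lra.

Set Implicit Arguments.
Unset Strict Implicit.
Unset Printing Implicit Defensive.
Import Order.TTheory GRing.Theory Num.Theory.
Import numFieldNormedType.Exports.
Local Open Scope classical_set_scope.
Local Open Scope ring_scope.

(** The test points [tv] and [tu] are chosen so that the duality gap
    [L un tv - L tu vn] is a sum of squares. Pairing the residual
    [r = F un - f] with its own Riesz image gives [|r|^2], while
    [F tu - f = - riesz_inv vn] and [B tu = g] give [L tu vn = - |vn|^2], so
    the gap equals [|B un - g|^2 / 2 + |r|^2 + |vn|^2] ([lagrangian_gap]). The
    stability estimate for the difference [un - u], which solves the problem
    with data [r] and [B un - g], bounds [|un - u|^2] by [C0] times the squared
    norms of these data ([stability]). Hence the left-hand side is at most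
    [1 + 2 |C0|] times the gap.

    The gap is bounded by the three error terms ([le_errors]): pass from
    [L un tv] to [L un qv], then to [Lhat un qv], then to [Lhat wu vn], then to
    [L wu vn], then to [L tu vn]. The first and last changes make up [I_NN],
    the second and fourth [I_MC], and the middle one is at most [I_GP] because
    [qv] and [wu] compete in its supremum and infimum.

    The value [L tu vn = - |vn|^2] needs [riesz (riesz_inv vn) = vn], that is,
    the Riesz representation theorem ([riesz_surj]). For [q] in the dual, the
    energy [|x|^2 / 2 - q x] is bounded below, and its near-minimisers [x]
    satisfy [riesz x ~ q] ([riesz_approx]). Since [riesz] is an isometry, a
    sequence with [riesz (x n)] converging to [q] is Cauchy, and its limit
    represents [q]. *)

(** * The Riesz representation theorem *)

Lemma dual_bound (R : realType) (V : normedModType R) (q : dual V) (x : V) :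
  `|q x| <= `|q| * `|x|.
Proof.
have [->|x0] := eqVneq x 0.
  by rewrite -[0 in leLHS](scale0r 0) dualZ mul0r !normr0 mulr0.
have := @dual_norm_ub _ _ q (`|x|^-1 *: x).
rewrite normrZ normfV normr_id mulVf ?normr_eq0// => /(_ (lexx _)).
by rewrite dualZ normrM normfV normr_id mulrC ler_pdivrMr ?normr_gt0.
Qed.

Lemma dualD (R : realType) (V : normedModType R) (q : dual V) (x y : V) :
  q (x + y) = q x + q y.
Proof. by have := dual_linear q 1 x y; rewrite scale1r mul1r. Qed.

Section riesz_representation.
Context (R : realType) (Z : realHilbertType R).

Lemma rieszB (x y : Z) : riesz (x - y) = riesz x - riesz y.
Proof.
apply/val_inj/funext => h /=.
by rewrite linearBl.
Qed.

Lemma riesz_norm (z : Z) : `|riesz z| = `|z|.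
Proof.
apply/eqP; rewrite eq_le; apply/andP; split.
  apply: dual_norm_le => x x1.
  by apply: le_trans (hdot_CS z x) _; rewrite ler_piMr.
have [->|z0] := eqVneq z 0; first by rewrite normr0.
have := dual_bound (riesz z) z.
by rewrite /= hdot_normE normrX normr_id expr2 ler_pM2r ?normr_gt0.
Qed.

(** The idea is a first variation with an error term: moving a near-minimiser
    [x] of the energy by [- a *: h], where [a = hdot x h - q h] is the defect
    and [h] is in the unit ball, lowers the energy by at least [a^2 / 2]. This
    cannot exceed the distance of the energy at [x] from its infimum. *)
Lemma riesz_approx (q : dual Z) (e : R) :
  0 < e -> exists x, `|riesz x - q| <= e.
Proof.
move=> e0.
pose J (x : Z) : R := `|x| ^+ 2 / 2 - q x.
have infJ : has_inf (range J).
  split; first by exists (J 0), 0.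
  exists (- (`|q| ^+ 2 / 2)) => _ [x _ <-].
  (* q x <= |q| |x| and the square (|x| - |q|)^2 bound the energy below *)
  have := le_trans (ler_norm _) (dual_bound q x).
  by rewrite /J; have := sqr_ge0 (`|x| - `|q|); nra.
have e2 : 0 < e ^+ 2 / 2 by rewrite divr_gt0// exprn_gt0.
(* energy excess e^2 / 2, so that a^2 / 2 <= e^2 / 2 *)
have [_ [x _ <-] Jx] := inf_adherent e2 infJ.
exists x; apply: dual_norm_le => h h1.
pose a := hdot x h - q h.
rewrite -[X in `|X|]/a.
have mJ : inf (range J) <= J (1 *: x + (- a) *: h).
  by apply: (ge_inf infJ.2); exists (1 *: x + (- a) *: h).
rewrite [leRHS]/J normD_hdot dualD !dualZ in mJ.
rewrite -(@ler_pXn2r _ 2) ?nnegrE ?(ltW e0)// real_normK ?num_real//.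
have h2 : `|h| ^+ 2 <= 1 by rewrite expr_le1.
have ah : a ^+ 2 * `|h| ^+ 2 <= a ^+ 2 by rewrite ler_piMr// sqr_ge0.
have aE : a ^+ 2 = a * hdot x h - a * q h by rewrite -mulrBr.
by move: Jx mJ; rewrite /J; lra.
Qed.

(** The range of the isometry [riesz] is dense by [riesz_approx], and closed
    because [Z] is complete. *)
Lemma riesz_surj (q : dual Z) : exists z, riesz z = q.
Proof.
have [x xq] := choice (fun n => riesz_approx q (harmonic_gt0 n)).
have near_q (e : R) : 0 < e -> \forall n \near \oo, `|riesz (x n) - q| <= e.
  move=> e0; near=> n; apply: le_trans (xq n) _.
  by near: n; exact: (cvgr_le 0 cvg_harmonic).
have cx : cvg (x @ \oo).
  apply/cauchy_cvgP/cauchy_exP => e e0.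
  have e2 : 0 < e / 2 / 2 by rewrite !divr_gt0.
  have [N _ xN] := near_q _ e2.
  exists (x N); exists N => // n /= Nn.
  rewrite -ball_normE /= -riesz_norm rieszB.
  rewrite -(subrKA q) (le_lt_trans (ler_normD _ _))// (distrC q).
  rewrite (le_lt_trans (lerD (xN _ _) (xN _ _)))//= -splitr.
  by rewrite ltr_pdivrMr// ltr_pMr// ltr1n.
exists (lim (x @ \oo)); apply/eqP; rewrite -subr_eq0 -normr_le0.
apply/ler_addgt0Pr => e e0; rewrite add0r.
have e2 : 0 < e / 2 by rewrite divr_gt0.
have [n [nq nx]] : exists n,
    `|riesz (x n) - q| <= e / 2 /\ `|lim (x @ \oo) - x n| <= e / 2.
  near \oo => n; exists n; split.
    by near: n; exact: near_q.
  by near: n; apply: cvgr_dist_le.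
rewrite -(subrKA (riesz (x n))) -rieszB (le_trans (ler_normD _ _))//.
by rewrite riesz_norm [leRHS](splitr e) lerD.
Unshelve. all: by end_near.
Qed.

Lemma riesz_invK (q : dual Z) : riesz (riesz_inv q) = q.
Proof. exact: (xgetPex 0 (riesz_surj q)). Qed.

End riesz_representation.

(** * The duality gap at the auxiliary points *)

Section gap.
Context (R : realType) (X : normedModType R) (Z : realHilbertType R)
  (P : normedModType R) (A : {linear X -> Z}) (B : {linear X -> P})
  (f : Z) (g : P).
Let L := lagrangian A B f g.

(** The factor [2^-1] appears only in front of the boundary term: the interior
    residual is paired with its own Riesz image, with full weight. *)
Lemma lagrangian_gap (w tu : X) (q : dual Z) :
  A tu - f = - riesz_inv q -> B tu = g ->
  L w (riesz (A w - f)) - L tu q =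
  2^-1 * `|B w - g| ^+ 2 + `|A w - f| ^+ 2 + `|q| ^+ 2.
Proof.
rewrite /L /lagrangian => -> ->.
rewrite subrr normr0 expr0n mulr0 add0r /= hdot_normE.
move: (riesz_inv q) (riesz_invK q) => z <-.
by rewrite riesz_norm /= linearNr opprK; congr (_ + _); exact: hdot_normE.
Qed.

(** By linearity [w - u] solves the problem whose data are the residuals
    of [w]. *)
Lemma stability (C0 : R) (u w : X) :
  (forall f g u, solves A B f g u ->
     `|u| ^+ 2 <= C0 * (`|f| ^+ 2 + `|g| ^+ 2)) ->
  solves A B f g u ->
  `|w - u| ^+ 2 <= C0 * (`|A w - f| ^+ 2 + `|B w - g| ^+ 2).
Proof.
move=> stab [Au Bu]; apply: stab; split; rewrite linearB.
  by rewrite Au.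
by rewrite Bu.
Qed.

End gap.

(** * Splitting the gap into the three errors *)

(** The sampled gap [Lhat un qv - Lhat wu vn] is bounded in the extended reals,
    as the supremum and the infimum in [I_GP] may be infinite; neither can have
    the sign that would spoil the bound, since [V] and [U] are nonempty. The
    other four differences are real and cost a triangle inequality. *)
Lemma le_errors (R : realType) (S T : Type) (L Lhat : S -> T -> R)
    (U : set S) (V : set T) (un tu wu : S) (vn tv qv : T) :
  U wu -> V qv ->
  ((L un tv - L tu vn)%:E <=
   (I_MC L Lhat un vn wu qv)%:E + (I_NN L un vn tu wu tv qv)%:E
   + I_GP Lhat U V un vn)%E.
Proof.
move=> Uwu Vqv.
have gap : ((Lhat un qv - Lhat wu vn)%:E <= I_GP Lhat U V un vn)%E.
  rewrite EFinB; apply: leeB.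
    by apply: ereal_sup_ubound; exists qv.
  by apply: ereal_inf_lbound; exists wu.
apply: le_trans (leeD (lexx _) gap).
rewrite -!EFinD lee_fin /I_MC /I_NN.
have := ler_norm (L un tv - L un qv).
have := ler_norm (L un qv - Lhat un qv).
have := ler_norm (- (L wu vn - Lhat wu vn)).
have := ler_norm (- (L tu vn - L wu vn)).
by rewrite !normrN; lra.
Qed.

Theorem theorem3 (R : realType) (d : nat) (Q Gamma : set 'rV[R]_d)
    (X : completeNormedModType R) (Z : realHilbertType R)
    (P : completeNormedModType R)
    (evX : X -> 'rV[R]_d -> R) (evZ : Z -> 'rV[R]_d -> R)
    (evP : P -> 'rV[R]_d -> R)
    (Xi : Type) (F : Xi -> {linear X -> Z}) (xi : Xi) (B : {linear X -> P}) :
  (1 < d)%N ->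
  is_domain Q -> bounded_set Q -> Gamma `<=` boundary Q ->
  function_space_on Q evX -> function_space_on Q evZ ->
  function_space_on Gamma evP ->
  well_posed (F xi) B ->
  exists2 C : R, 0 < C &
    forall (f : Z) (g : P) (u : X) (v : dual Z),
    let L := lagrangian (F xi) B f g in
    solves (F xi) B f g u -> v = 0 -> saddle_solution L u v ->
    forall (p q : nat) (uNN : 'rV[R]_p -> X) (vNN : 'rV[R]_q -> dual Z)
      (IQ : interior_integral Q (F xi) f) (IG : boundary_integral Gamma B g)
      (samples : nat -> sample IQ * sample IG)
      (theta0 : 'rV[R]_p) (tau0 : 'rV[R]_q)
      (l k s : nat) (eta_theta eta_tau gamma : R) (n : nat),
    (0 < l)%N -> (0 < k)%N -> (0 < s)%N ->
    0 < eta_theta -> 0 < eta_tau -> 0 < gamma < 1 ->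
    forall (un : X) (vn : dual Z),
    (un, vn) = gda uNN vNN (fun e => empirical_lagrangian (samples e))
                 l k s eta_theta eta_tau gamma theta0 tau0 n ->
    forall (smp : sample IQ * sample IG) (tu wu : X) (tv qv : dual Z),
    let Lhat := empirical_lagrangian smp in
    tv = riesz (F xi un - f) ->
    F xi tu - f = - riesz_inv vn -> B tu = g ->
    is_argmin (range vNN) (fun q => `|q - tv|) qv ->
    is_argmin (range uNN) (fun w => `|w - tu|) wu ->
    ((`|un - u| ^+ 2 + `|vn - v| ^+ 2)%:E <=
       C%:E * ((I_MC L Lhat un vn wu qv)%:E + (I_NN L un vn tu wu tv qv)%:E
               + I_GP Lhat (range uNN) (range vNN) un vn))%E.
Proof.
move=> _ _ _ _ _ _ _ [_ [C0 stab]].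
(* the 2 compensates the factor 1/2 of the boundary term in the gap; the 1
   makes the coefficient of |vn|^2 at least 1 and C positive *)
exists (1 + 2 * `|C0|) => [|f g u v L uP -> _]; first by rewrite ltr_pwDl.
move=> p q uNN vNN IQ IG samples theta0 tau0 l k s eta_theta eta_tau gamma n.
move=> _ _ _ _ _ _ un vn _ smp tu wu tv qv Lhat -> Atu Btu [Vqv _] [Uwu _].
have := @le_errors _ _ _ L Lhat _ _ un tu wu vn (riesz (F xi un - f)) qv Uwu Vqv.
rewrite /L (lagrangian_gap _ Atu Btu) => errs.
have C0' : 0 <= 1 + 2 * `|C0| by rewrite addr_ge0// mulr_ge0.
apply: le_trans (lee_wpmul2l _ errs); last by rewrite lee_fin.
rewrite -EFinM lee_fin subr0.
have := stability un stab uP.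
have := ler_norm C0; have := normr_ge0 C0.
have := sqr_ge0 `|F xi un - f|; have := sqr_ge0 `|B un - g|.
have := sqr_ge0 `|vn|.
move: (`|un - u| ^+ 2) (`|vn| ^+ 2) (`|B un - g| ^+ 2) (`|F xi un - f| ^+ 2) (`|C0|).
move=> a b c D K.
by nra.
Qed.
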